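(* Let $n\ge3$, $d\ge2$ and $k$ be integers with $k\ge d^{n-2}$ and $(n,d)\neq(3,2)$. Then the algebra $T_{n,d,k}=\mathbb{C}[x_1,\ldots,x_n]/(x_1^d,\ldots,x_n^d)^k$ fails the weak Lefschetz property.
   Context: A standard graded algebra $A=\bigoplus_i A_i$ over $\mathbb{C}$ satisfies the weak Lefschetz property (WLP) if there exists a linear form $L\in A_1$ such that for every degree $i$ the multiplication map $\times L\colon A_i\to A_{i+1}$ has maximal rank, i.e. is injective or surjective. It fails the WLP if no such $L$ exists. Here $(x_1^d,\ldots,x_n^d)^k$ is the $k$-th power of the ideal generated by $x_1^d,\dots,x_n^d$. *)

(* Defs.v *)
From HB Require Import structures.
From mathcomp Require Import all_boot all_order all_algebra.
From mathcomp Require Import boolp classical_sets functions reals.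
From mathcomp Require Import complex mpoly.

Set Implicit Arguments.
Unset Strict Implicit.
Unset Printing Implicit Defensive.

Import GRing.Theory.

Local Open Scope ring_scope.
Local Open Scope classical_set_scope.
Local Open Scope quotient_scope.
Local Open Scope complex_scope.

(* [idealr] of ring_quotient.v only covers proper ideals; all ideals are
   allowed here, so that the quotient below is total in its parameters. *)
Record ideal (R : comPzRingType) := Ideal {
  ideal_set :> R -> Prop;
  ideal0 : ideal_set 0;
  idealMD : forall a u v, ideal_set u -> ideal_set v -> ideal_set (a * u + v)
}.

Section Ideals.
Variable R : comPzRingType.
Implicit Types (S : set R) (I J : ideal R).

Definition span_set S : set R :=
  [set x | exists2 s : seq (R * R), (forall p, p \in s -> S p.2) &
           x = \sum_(p <- s) p.1 * p.2].

Lemma span_set0 S : span_set S 0.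
Proof. by exists [::]; rewrite ?big_nil. Qed.

Lemma span_setMD S a u v :
  span_set S u -> span_set S v -> span_set S (a * u + v).
Proof.
move=> [s Ss ->] [t St ->]; exists ([seq (a * p.1, p.2) | p <- s] ++ t).
  by move=> p; rewrite mem_cat => /orP[/mapP[q /Ss Sq ->]|/St].
rewrite big_cat big_map mulr_sumr; congr (_ + _).
by apply: eq_bigr => p _; rewrite mulrA.
Qed.

Definition ideal_span S : ideal R := Ideal (@span_set0 S) (@span_setMD S).

Definition ideal_mul I J : ideal R := ideal_span [set a * b | a in ideal_set I & b in ideal_set J].

Definition ideal_exp I k : ideal R :=
  iter k (ideal_mul I) (ideal_span [set 1]).

End Ideals.

Section Quotient.
Variables (R : comPzRingType) (I : ideal R).

Definition ideal_pred : {pred R} := fun x => `[< I x >].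

Lemma ideal_pred_zmod : zmod_closed ideal_pred.
Proof.
split=> [|x y /asboolP Ix /asboolP Iy]; apply/asboolP; first exact: ideal0.
by rewrite addrC -mulN1r; apply: idealMD.
Qed.

HB.instance Definition _ := GRing.isZmodClosed.Build R ideal_pred ideal_pred_zmod.

Definition ring_quot : Type := @Quotient.quot R ideal_pred.

HB.instance Definition _ := EqQuotient.on ring_quot.
HB.instance Definition _ := GRing.Zmodule.on ring_quot.

Definition quot_map : R -> ring_quot := \pi_ring_quot.

Lemma quot_map_eq x y : quot_map x = quot_map y <-> I (x - y).
Proof.
rewrite /quot_map; split=> [/eqmodP|Ixy]; last apply/eqmodP.
  by rewrite /= Quotient.equivE => /asboolP.
by rewrite /= Quotient.equivE; apply/asboolP.
Qed.

Lemma quot_mapK x : quot_map (repr x) = x.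
Proof. exact: reprK. Qed.

Lemma quot_map_zmod : zmod_morphism quot_map.
Proof. exact: (@pi_is_zmod_morphism R _ _ (@Quotient.quot R ideal_pred)). Qed.

HB.instance Definition _ :=
  GRing.isZmodMorphism.Build R ring_quot quot_map quot_map_zmod.

Definition quot_mul (x y : ring_quot) : ring_quot := quot_map (repr x * repr y).

Lemma quot_mapM : {morph quot_map : x y / x * y >-> quot_mul x y}.
Proof.
move=> x y; apply/quot_map_eq.
have I0 := ideal0 I.
set x' := repr _; set y' := repr _.
have Ix : I (x - x') by apply/quot_map_eq; rewrite quot_mapK.
have Iy : I (y - y') by apply/quot_map_eq; rewrite quot_mapK.
have -> : x * y - x' * y' = y * (x - x') + (x' * (y - y') + 0).
  by rewrite addr0 !mulrBr ![y * _]mulrC addrA subrK.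
by apply: idealMD => //; apply: idealMD.
Qed.

Lemma quot_mulA : associative quot_mul.
Proof.
by move=> x y z; rewrite -[x]quot_mapK -[y]quot_mapK -[z]quot_mapK -!quot_mapM mulrA.
Qed.

Lemma quot_mulC : commutative quot_mul.
Proof. by move=> x y; rewrite -[x]quot_mapK -[y]quot_mapK -!quot_mapM mulrC. Qed.

Lemma quot_mul1 : left_id (quot_map 1) quot_mul.
Proof. by move=> x; rewrite -[x]quot_mapK -!quot_mapM mul1r. Qed.

Lemma quot_mulDl : left_distributive quot_mul +%R.
Proof.
move=> x y z; rewrite -[x]quot_mapK -[y]quot_mapK -[z]quot_mapK.
by rewrite -!quot_mapM -!raddfD /= -quot_mapM mulrDl.
Qed.

HB.instance Definition _ := GRing.Zmodule_isComPzRing.Build ring_quot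
  quot_mulA quot_mulC quot_mul1 quot_mulDl.

Lemma quot_map_monoid : monoid_morphism quot_map.
Proof. by split=> // x y; rewrite quot_mapM. Qed.

HB.instance Definition _ :=
  GRing.isMonoidMorphism.Build R ring_quot quot_map quot_map_monoid.

End Quotient.

(* [gr i] is the degree-[i] component of the graded algebra [A]. *)
Definition weak_lefschetz (A : comPzRingType) (gr : nat -> set A) : Prop :=
  exists2 L : A, gr 1%N L &
    forall i : nat,
      set_inj (gr i) ( *%R L) \/ set_surj (gr i) (gr i.+1) ( *%R L).

(* The standard grading inherited by a quotient of a polynomial ring; it is
   meaningful when [J] is a homogeneous ideal. *)
Definition quot_grade (K : comNzRingType) (n : nat) (J : ideal {mpoly K[n]})
    (i : nat) : set (ring_quot J) :=
  [set quot_map J p | p in [set p : {mpoly K[n]} | p \is i.-homog]].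
Arguments quot_grade {K n} J i.

Definition powers_ideal (K : comNzRingType) (n d : nat) : ideal {mpoly K[n]} :=
  ideal_span [set ('X_i ^+ d : {mpoly K[n]}) | i in [set: 'I_n]].

(* [R[i]] is the field of complex numbers: a [realType] is a complete
   archimedean ordered field, hence a copy of the real numbers. *)
Definition T_algebra (R : realType) (n d k : nat) : comPzRingType :=
  ring_quot (ideal_exp (powers_ideal R[i] n d) k).

Definition T_grade (R : realType) (n d k : nat) : nat -> set (T_algebra R n d k) :=
  quot_grade (ideal_exp (powers_ideal R[i] n d) k).

(* Main.v *)
(* Maximal rank fails in degree [d * k - 1] for every linear form [l].

   Not injective: the product of the [d ^ (n - 1)] conjugates of [l] under
   multiplication of the variables by [d]-th roots of unity is a multiple
   [l * g] of [l] and a form of degree [d ^ (n - 2)] in the powers [x_i ^ d].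
   Multiplying [g] by a power of [x_0 ^ d] gives a nonzero form of degree
   [d * k - 1], hence nonzero in the quotient, which is killed by [l].

   Not surjective: in degree [d * k] the ideal consists of forms in the
   [x_i ^ d], so it takes the same values at [u] and [z * u] whenever all
   [z_i ^ d = 1].  If moreover [l] vanishes at both points, the image of [l] is
   in the kernel of the functional [p |-> p(z * u) - p(u)], which is nonzero
   unless [z] is constant on the support of [u].  Such [u] and [z] exist
   except for [(n, d) = (3, 2)]. *)
Require Import Defs.
From mathcomp Require Import all_boot all_order all_algebra.
From mathcomp Require Import cyclic separable cyclotomic.
From mathcomp Require Import boolp classical_sets functions reals.
From mathcomp Require Import complex mpoly.
From mathcomp Require Import zify ring.

Set Implicit Arguments.
Unset Strict Implicit.
Unset Printing Implicit Defensive.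

Import GRing.Theory Num.Theory.

Local Open Scope ring_scope.

(** * Primitive roots of unity *)

(** ['X^n - 1] splits and, in characteristic 0, is separable; its [n] distinct roots form a set of
    [n]-th roots of unity large enough to contain a primitive one. *)
Lemma prim_root_exists (C : numClosedFieldType) (n : nat) :
  (0 < n)%N -> exists z : C, n.-primitive_root z.
Proof.
move=> n_gt0; have [r Dp] := closed_field_poly_normal ('X^n - 1 : {poly C}).
rewrite (monicP _) ?monicXnsubC // scale1r in Dp.
have rn1: all n.-unity_root r by apply/allP => z; rewrite -root_prod_XsubC -Dp.
have sz_r: (n < (size r).+1)%N.
  by rewrite -(size_prod_XsubC r id) -Dp size_XnsubC.
have [|z] := hasP (has_prim_root n_gt0 rn1 _ sz_r); last by exists z.
by rewrite -separable_prod_XsubC -Dp separable_Xn_sub_1 // pnatr_eq0 -lt0n.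
Qed.

(** * Low-degree forms in the powers of the ideal generated by the [x_i ^ d] *)

Section IdealPowers.
Variables (K : comNzRingType) (n d : nat).
Implicit Types (p q : {mpoly K[n]}) (m : 'X_{1..n}).

(** Membership in the subring of polynomials in the powers [x_i ^ d], read off the exponents. *)
Definition power_supp p := forall m, m \in msupp p -> forall i, (d %| m i)%N.

(** The bound survives sums and multiples, since exponents only grow. Each further factor from the
    ideal raises it by one, because [m i %/ d] is superadditive in [m]. *)
Lemma ideal_exp_supp k p m : (0 < d)%N ->
  ideal_exp (powers_ideal K n d) k p -> m \in msupp p ->
  (k <= \sum_i m i %/ d)%N.
Proof.
move=> d_gt0; have MD j (a u v : {mpoly K[n]}) :
    (forall m', m' \in msupp u -> (j <= \sum_i m' i %/ d)%N) ->
    (forall m', m' \in msupp v -> (j <= \sum_i m' i %/ d)%N) ->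
    forall m', m' \in msupp (a * u + v) -> (j <= \sum_i m' i %/ d)%N.
  move=> Hu Hv m' /msuppD_le; rewrite mem_cat => /orP[|/Hv//].
  case/msuppM_le/allpairsP=> -[m1 m2] /= [_ /Hu le_j ->].
  apply: leq_trans le_j _; apply: leq_sum => i _.
  by rewrite mnmDE leq_div2r // leq_addl.
have span j (S : set {mpoly K[n]}) :
    (forall q, S q -> forall m', m' \in msupp q -> (j <= \sum_i m' i %/ d)%N) ->
    forall q, span_set S q ->
    forall m', m' \in msupp q -> (j <= \sum_i m' i %/ d)%N.
  move=> HS q [s Ss ->]; elim: s Ss => [|x s IHs] Ss m'.
    by rewrite big_nil msupp0.
  rewrite big_cons; apply: MD.
    by apply: HS; apply: Ss; rewrite mem_head.
  by apply: IHs => y ys; apply: Ss; rewrite inE ys orbT.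
elim: k p m => [|k IHk] p m //; rewrite /ideal_exp iterS => Ip.
apply: (span k.+1 _ _ p Ip) m => q [a Ia [b Ib <-]] m.
have {}Ia : forall m', m' \in msupp a -> (1 <= \sum_i m' i %/ d)%N.
  apply: (span 1%N _ _ a Ia) => _ [i _ <-] m'; rewrite mpolyXn msuppX inE => /eqP->.
  by rewrite (bigD1 i) //= mulmnE mnm1E eqxx mul1n divnn d_gt0.
case/msuppM_le/allpairsP=> -[m1 m2] /= [/Ia m1a m2b ->].
apply: leq_trans (_ : (\sum_i m1 i %/ d + \sum_i m2 i %/ d <= _)%N).
  by rewrite -add1n leq_add // (IHk b).
rewrite -big_split /=; apply: leq_sum => i _; rewrite mnmDE.
by rewrite leq_divRL // mulnDl leq_add // leq_divM.
Qed.

Lemma ideal_exp_mnm (c : 'X_{1..n}) :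
  ideal_exp (powers_ideal K n d) (mdeg c) 'X_[(c *+ d)%MM].
Proof.
have gen (R : comPzRingType) (S : set R) x : S x -> span_set S x.
  move=> Sx; exists [:: (1, x)]; last by rewrite big_seq1 mul1r.
  by move=> y; rewrite inE => /eqP->.
move: {2}(mdeg c) (erefl (mdeg c)) => k; elim: k c => [|k IHk] c dc.
  move: dc => /eqP; rewrite mdeg_eq0 => /eqP->.
  have -> : (0 *+ d)%MM = 0%MM :> 'X_{1..n}.
    by apply/mnmP => i; rewrite mulmnE mnm0E.
  by rewrite mdeg0 mpolyX0; apply: gen.
have [i ci] : exists i, (0 < c i)%N.
  apply/existsP; apply: contraPT dc; rewrite negb_exists => /forallP c0.
  by rewrite mdegE big1 // => i _; apply/eqP; rewrite -leqn0 leqNgt.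
have ic : (U_(i) <= c)%MM.
  by apply/mnm_lepP => j; rewrite mnm1E; case: eqP => [<-|].
rewrite -(submK ic) mdegD mdeg1 addn1 /ideal_exp iterS.
have Xi : ideal_set (powers_ideal K n d) ('X_i ^+ d) by apply: gen; exists i.
apply: gen; exists ('X_i ^+ d) => //; rewrite mpolyXn.
exists 'X_[(c - U_(i)) *+ d]; last first.
  rewrite -mpolyXD; congr 'X_[_]; apply/mnmP => j.
  by rewrite !(mnmDE, mulmnE) mulnDl addnC.
by apply: IHk; apply/eqP; rewrite -eqSS -dc -{2}(submK ic) mdegD mdeg1 addn1.
Qed.

Lemma power_supp_ideal_exp k p : (0 < d)%N ->
  p \is (d * k).-homog -> power_supp p ->
  ideal_exp (powers_ideal K n d) k p.
Proof.
move=> d_gt0 /dhomogP hp Pp; rewrite [p]mpolyE big_seq.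
elim/big_rec: _ => [|m q mp Iq]; first exact: ideal0.
rewrite -mul_mpolyC; apply: idealMD => //.
have Em : m = ([multinom (m i %/ d)%N | i < n] *+ d)%MM.
  by apply/mnmP => i; rewrite mulmnE mnmE divnK // Pp.
suff -> : k = mdeg [multinom (m i %/ d)%N | i < n].
  by rewrite [X in 'X_[X]]Em; apply: ideal_exp_mnm.
apply/eqP; rewrite -(eqn_pmul2l d_gt0) -(hp _ mp).
by rewrite [X in mdeg X == _]Em mdegMn mulnC.
Qed.

Lemma ideal_exp_homog_lt k p j : (0 < d)%N -> (j < d * k)%N ->
  p \is j.-homog -> ideal_exp (powers_ideal K n d) k p -> p = 0.
Proof.
move=> d_gt0 lt_j /dhomogP hp Ip; apply/eqP; rewrite -msupp_eq0.
case Es: (msupp p) => [//|m s]; have mp : m \in msupp p by rewrite Es mem_head.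
have := ideal_exp_supp d_gt0 Ip mp; rewrite leqNgt; case/negP.
rewrite -(ltn_pmul2l d_gt0); apply: leq_ltn_trans lt_j.
rewrite -(hp _ mp : mdeg m = _) mdegE big_distrr.
by apply: leq_sum => i _; rewrite /= mulnC leq_divM.
Qed.

(** In degree [d * k] the bound [k <= \sum_i m i %/ d] is attained, so no division by [d] leaves a
    remainder. *)
Lemma ideal_exp_homog_supp k p : (0 < d)%N ->
  p \is (d * k).-homog -> ideal_exp (powers_ideal K n d) k p -> power_supp p.
Proof.
move=> d_gt0 /dhomogP hp Ip m mp i.
have le_k := ideal_exp_supp d_gt0 Ip mp.
have le_m (j : 'I_n) : true -> (d * (m j %/ d) <= m j ?= iff (d %| m j))%N.
  move=> _; split; first by rewrite mulnC leq_divM.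
  by rewrite mulnC dvdn_eq.
have [_] := leqif_sum le_m; rewrite -big_distrr /= -mdegE (hp _ mp : mdeg m = _).
have le_d : (\sum_j m j %/ d <= k)%N.
  rewrite -(leq_pmul2l d_gt0) -(hp _ mp : mdeg m = _) mdegE big_distrr.
  by apply: leq_sum => j _; case: (le_m j).
by rewrite eqn_leq !leq_mul2l le_k le_d !orbT => /esym/forallP/(_ i).
Qed.

Lemma power_supp_meval p (z u : 'I_n -> K) :
  (forall i, z i ^+ d = 1) -> power_supp p ->
  p.@[fun i => z i * u i] = p.@[u].
Proof.
move=> zd Pp; rewrite !mevalE big_seq [RHS]big_seq; apply: eq_bigr => m mp.
congr (_ * _); apply: eq_bigr => i _; rewrite exprMn.
by have /dvdnP[c ->] := Pp m mp i; rewrite [(c * d)%N]mulnC exprM zd expr1n mul1r.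
Qed.

End IdealPowers.

(** * Norms of a form under rescaling of variables by roots of unity *)

Section Norm.
Variables (K : fieldType) (n d : nat) (w : K).
Hypothesis w_prim : d.-primitive_root w.
Implicit Types (p q : {mpoly K[n]}) (i : 'I_n).

Definition rescale (c : K) i p : {mpoly K[n]} :=
  p \mPo [tuple (if j == i then c else 1) *: 'X_j | j < n].

Lemma mcoeff_rescale c i p m : (rescale c i p)@_m = c ^+ m i * p@_m.
Proof.
rewrite /rescale comp_mpolyEX raddf_sum /=.
have E (m' : 'X_{1..n}) :
    'X_[m'] \mPo [tuple (if j == i then c else 1) *: 'X_j | j < n]
    = c ^+ m' i *: 'X_[m'] :> {mpoly K[n]}.
  rewrite comp_mpolyX (eq_bigr (fun j =>
    (if j == i then c else 1) ^+ m' j *: 'X_j ^+ m' j : {mpoly K[n]})); last first.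
    by move=> j _; rewrite tnth_mktuple exprZn.
  rewrite scaler_prod -mpolyXE_id (bigD1 i) //= eqxx big1 ?mulr1 // => j /negPf->.
  by rewrite expr1n.
under eq_bigr do rewrite E scalerA mcoeffZ mcoeffX.
case: (boolP (m \in msupp p)) => [mp|mNp].
  rewrite (bigD1_seq m) ?msupp_uniq //= eqxx mulr1 big1 ?addr0 1?mulrC // => m'.
  by move=> /negPf->; rewrite mulr0.
rewrite (memN_msupp_eq0 mNp) mulr0 big_seq big1 // => m' m'p.
by case: eqP mNp => [<-|_ _]; rewrite ?m'p // mulr0.
Qed.

Lemma rescaleM c i : {morph rescale c i : p q / p * q}.
Proof. by move=> p q; rewrite /rescale rmorphM. Qed.

Lemma rescale_rescale b c i p : rescale b i (rescale c i p) = rescale (b * c) i p.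
Proof. by apply/mpolyP => m; rewrite !mcoeff_rescale exprMn mulrA. Qed.

Lemma rescale1 i p : rescale 1 i p = p.
Proof. by apply/mpolyP => m; rewrite mcoeff_rescale expr1n mul1r. Qed.

Lemma msupp_rescale c i p : {subset msupp (rescale c i p) <= msupp p}.
Proof.
by move=> m; rewrite !mcoeff_msupp mcoeff_rescale mulf_eq0 negb_or => /andP[].
Qed.

Lemma rescale_homog c i p e : p \is e.-homog -> rescale c i p \is e.-homog.
Proof. by move=> /dhomogP hp; apply/dhomogP => m /msupp_rescale/hp. Qed.

Lemma rescale_neq0 c i p : c != 0 -> p != 0 -> rescale c i p != 0.
Proof.
move=> c0; apply: contra_neq => p0.
by rewrite -[p](rescale1 i) -(mulVf c0) -rescale_rescale p0 /rescale comp_mpoly0.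
Qed.

Lemma dhomog_big_prod (I : Type) (s : seq I) (F : I -> {mpoly K[n]}) e :
  (forall x, F x \is e.-homog) -> \prod_(x <- s) F x \is (e * size s).-homog.
Proof.
move=> hF; elim: s => [|x s IHs]; first by rewrite big_nil muln0 dhomog1.
by rewrite big_cons /= mulnS dhomogM.
Qed.

(** The product is invariant under rescaling [x_i] by [w], so a nonzero coefficient at [m] forces
    [w ^+ m i = 1]. *)
Lemma norm_supp i p m :
  m \in msupp (\prod_(0 <= t < d) rescale (w ^+ t) i p) -> (d %| m i)%N.
Proof.
set F := \prod_(_ <= _ < _) _.
have FE : rescale w i F = F.
  have d_gt0 := prim_order_gt0 w_prim.
  (* Rescaling by [w] shifts the factors cyclically: the last one moves to [w ^+ d = 1], which is
     the factor at [t = 0]. *)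
  rewrite /F -(prednK d_gt0) [in RHS]big_nat_recl // [in LHS]big_nat_recr //=.
  rewrite rescaleM rescale_rescale -exprS (prednK d_gt0) (prim_expr_order w_prim).
  rewrite expr0 mulrC; congr (_ * _).
  rewrite /rescale rmorph_prod /=; apply: eq_bigr => t _.
  by rewrite -/(rescale _ _ _) -/(rescale _ _ _) rescale_rescale -exprS.
rewrite mcoeff_msupp => Fm; have := congr1 (mcoeff m) FE.
rewrite mcoeff_rescale -[RHS]mul1r => /(mulIf Fm)/eqP.
by rewrite -(prim_order_dvd w_prim).
Qed.

(* [l * g] is the product of the conjugates of [l] under rescaling the first
   [j] variables by [d]-th roots of unity. *)
Lemma partial_norm (l : {mpoly K[n]}) j : (j <= n)%N ->
  l != 0 -> l \is 1.-homog ->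
  exists g : {mpoly K[n]}, [/\ g != 0, g \is (d ^ j).-1.-homog &
    forall m, m \in msupp (l * g) -> forall i : 'I_n, (i < j)%N -> (d %| m i)%N].
Proof.
have d_gt0 := prim_order_gt0 w_prim.
move=> + l0 hl; elim: j => [_|j IHj ltjn].
  by exists 1; rewrite oner_eq0 dhomog1; split.
have [g [g0 hg Pg]] := IHj (ltnW ltjn).
have hlg : l * g \is (d ^ j).-homog.
  by rewrite -[X in X.-homog]prednK ?expn_gt0 ?d_gt0 // -add1n dhomogM.
pose i := Ordinal ltjn.
have w0 t : w ^+ t != 0.
  by rewrite expf_neq0 // -unitfE -(unitrX_pos _ d_gt0) (prim_expr_order w_prim) unitr1.
(* The norm of [l * g] in the next variable has [l * g] as its factor at [t = 0]; removing [l] from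
   it leaves the new cofactor. *)
exists (g * \prod_(1 <= t < d) rescale (w ^+ t) i (l * g)); split.
- rewrite mulf_neq0 // prodf_seq_neq0; apply/allP => t _.
  by rewrite rescale_neq0 // mulf_neq0.
- have -> : (d ^ j.+1).-1 = ((d ^ j).-1 + d ^ j * size (index_iota 1 d))%N.
    rewrite size_iota expnS.
    have : (0 < d ^ j)%N by rewrite expn_gt0 d_gt0.
    by case: (d) d_gt0 => // d' _; rewrite subSS subn0; nia.
  by rewrite dhomogM // dhomog_big_prod // => t; apply: rescale_homog.
have -> : l * (g * \prod_(1 <= t < d) rescale (w ^+ t) i (l * g)) =
    \prod_(0 <= t < d) rescale (w ^+ t) i (l * g).
  by rewrite [RHS]big_ltn // expr0 rescale1 mulrA.
(* The new variable is handled by invariance of the norm; for the earlier ones, divisibility passes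
   from [l * g] to its rescalings and to their product. *)
move=> m mF i'; rewrite ltnS leq_eqVlt => /orP[/eqP ij|ltij].
  by rewrite (_ : i' = i); [exact: norm_supp mF | exact: ord_inj].
elim/big_rec: _ m mF => [|t F _ PF] m.
  by rewrite msupp1 inE => /eqP->; rewrite mnm0E.
case/msuppM_le/allpairsP=> -[m1 m2] /= [/msupp_rescale m1p m2F ->].
by rewrite mnmDE dvdn_add ?(PF _ m2F) ?(Pg _ m1p).
Qed.

End Norm.

(** * Conjugate points on a hyperplane *)

Lemma meval_homog1 (K : comNzRingType) (n : nat) (l : {mpoly K[n]}) u :
  l \is 1.-homog -> l.@[u] = \sum_i l@_U_(i) * u i.
Proof.
move=> hl; have {1}-> : l = \sum_i l@_U_(i) *: 'X_i.
  apply/mpolyP => m; rewrite raddf_sum /=.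
  under eq_bigr do rewrite mcoeffZ mcoeffX.
  have [/eqP/mdeg1P[j /eqP->]|m1] := eqVneq (mdeg m) 1%N.
    rewrite (bigD1 j) //= eqxx mulr1 big1 ?addr0 // => i /negPf ij.
    by rewrite eq_mnm1 ij mulr0.
  rewrite (dhomog_nemf_coeff hl m1) big1 // => i _.
  rewrite (_ : (U_(i)%MM == m) = false) ?mulr0 //.
  by apply: contra_neqF m1 => /eqP <-; rewrite mdeg1.
by rewrite raddf_sum /=; apply: eq_bigr => i _; rewrite mevalZ mevalXU.
Qed.

(* The map [x_i |-> x_i ^ d] identifies [u] with [z * u], and both points lie on
   the hyperplane [a = 0]. *)
Lemma hyperplane_conjugate_points (K : fieldType) (n d : nat) (w : K) (a : 'I_n -> K) :
  (3 <= n)%N -> (2 <= d)%N -> (n, d) <> (3%N, 2%N) -> d.-primitive_root w ->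
  exists (u z : 'I_n -> K) i j, [/\ forall k, z k ^+ d = 1,
    \sum_k a k * u k = 0, \sum_k a k * (z k * u k) = 0 &
    [/\ u i != 0, u j != 0 & z i != z j]].
Proof.
case: n a => [|[|[|n]]] // a _ d_ge2 nd w_prim.
have wd := prim_expr_order w_prim.
have w1 : w != 1.
  by apply/eqP => E; have := prim_order_dvd w_prim 1; rewrite expr1 E eqxx dvdn1; lia.
have [/existsP[m /eqP am]|a0] := boolP [exists m, a m == 0].
  (* When [a m = 0] the coordinate [u m] is free. Taking [z] equal to 1 at [m] and to [w] elsewhere
     multiplies the remaining relation [a i * s + a j * t = 0] by [w]. *)
  pose i := lift m (0 : 'I_n.+2); pose j := lift m (1 : 'I_n.+2).
  have mi : m != i by rewrite neq_lift.
  have mj : m != j by rewrite neq_lift.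
  have ij : i != j by rewrite (inj_eq lift_inj).
  have [s [t [st0 st]]] : exists s t, [/\ a i * s + a j * t = 0 & (s != 0) || (t != 0)].
    have [->|ai] := eqVneq (a i) 0.
      by exists 1, 0; rewrite mul0r mulr0 addr0 oner_eq0.
    by exists (- a j), (a i); rewrite ai orbT; split=> //; ring.
  pose u k := if k == i then s else if k == j then t else (k == m)%:R.
  pose z k := if k == m then 1 else w.
  have ui : u i = s by rewrite /u eqxx.
  have uj : u j = t by rewrite /u eqxx eq_sym (negPf ij).
  have um : u m = 1 by rewrite /u (negPf mi) (negPf mj) eqxx.
  have zm : z m = 1 by rewrite /z eqxx.
  have zi : z i = w by rewrite /z eq_sym (negPf mi).
  have zj : z j = w by rewrite /z eq_sym (negPf mj).
  have sumE (F : 'I_n.+3 -> K) : (forall k, u k = 0 -> F k = 0) ->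
      \sum_k F k = F m + (F i + F j).
    move=> F0; rewrite (bigD1 m) // (bigD1 i) 1?eq_sym //= (bigD1 j) /=; last first.
      by rewrite ![j == _]eq_sym mj ij.
    rewrite big1 ?addr0 // => k /andP[/andP[km ki] kj].
    by apply: F0; rewrite /u (negPf ki) (negPf kj) (negPf km).
  have su : \sum_k a k * u k = 0.
    by rewrite sumE => [|k ->]; rewrite ?mulr0 // am ui uj mul0r add0r.
  have szu : \sum_k a k * (z k * u k) = 0.
    rewrite sumE => [|k ->]; last by rewrite !mulr0.
    by rewrite am ui uj zi zj mul0r add0r !(mulrCA _ w) -mulrDr st0 mulr0.
  have zd k : z k ^+ d = 1 by rewrite /z; case: ifP; rewrite ?expr1n.
  case/orP: st => [s0|t0].
    by exists u, z, i, m; split=> //; rewrite ui um zi zm oner_eq0.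
  by exists u, z, j, m; split=> //; rewrite uj um zj zm oner_eq0.
have {}a0 k : a k != 0 by rewrite negb_exists in a0; apply: (forallP a0).
pose i0 : 'I_n.+3 := ord0; pose i1 : 'I_n.+3 := lift ord0 ord0.
case: n @i0 @i1 a a0 nd => [|n] i0 i1 a a0 nd.
  pose i2 : 'I_3 := lift ord0 (lift ord0 ord0).
  (* This is where [(n, d) = (3, 2)] has to be excluded. *)
  have w2 : w ^+ 2 != 1.
    have d3 : (2 < d)%N.
      rewrite ltn_neqAle d_ge2 andbT; apply/eqP => d2; apply: nd.
      by rewrite -d2.
    by rewrite -(prim_order_dvd w_prim); apply/negP => /dvdn_leq; lia.
  have w0 : w != 0.
    by rewrite -unitfE -(unitrX_pos _ (ltnW d_ge2)) wd unitr1.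
  (* Up to the common factor [a i0 * a i1 * a i2], the products [a k * u k] are the cross product of
     [(1, 1, 1)] and [(1, w, w ^+ 2)], hence orthogonal to both. *)
  exists (fun k : 'I_3 => nth 0 [:: a i1 * a i2 * (w * (w - 1));
    a i0 * a i2 * (1 - w ^+ 2); a i0 * a i1 * (w - 1)] k), (fun k => w ^+ k), i0, i1.
  split.
  - by move=> k; rewrite -exprM mulnC exprM wd expr1n.
  - by rewrite !big_ord_recl big_ord0 /= -/i0 -/i1 -/i2; ring.
  - by rewrite !big_ord_recl big_ord0 /= -/i0 -/i1 -/i2; ring.
  split; rewrite /= ?expr0 ?expr1; last by rewrite eq_sym.
    by rewrite !mulf_neq0 // subr_eq0.
  by rewrite !mulf_neq0 // subr_eq0 eq_sym.
pose i2 : 'I_n.+4 := lift ord0 (lift ord0 ord0).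
pose i3 : 'I_n.+4 := lift ord0 (lift ord0 (lift ord0 ord0)).
(* Coordinates 0, 1 and coordinates 2, 3 cancel separately, so the first pair can be scaled by [w]
   alone; [u] vanishes beyond them. *)
exists (fun k : 'I_n.+4 => nth 0 [:: a i1; - a i0; a i3; - a i2] k),
  (fun k => if (k < 2)%N then w else 1), i0, i2; split.
- by move=> k; case: ifP; rewrite ?expr1n.
- rewrite !big_ord_recl big1 /= => [|k _]; last by rewrite nth_nil mulr0.
  by rewrite -/i0 -/i1 -/i2 -/i3; ring.
- rewrite !big_ord_recl big1 /= => [|k _]; last by rewrite nth_nil !mulr0.
  by rewrite -/i0 -/i1 -/i2 -/i3; ring.
by split; rewrite /= ?a0.
Qed.

(** * The two obstructions to maximal rank in degree [d * k - 1] *)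

Section QuotientMaps.
Variables (K : fieldType) (n d k : nat).
Hypotheses (d_gt0 : (0 < d)%N) (k_gt0 : (0 < k)%N).
Local Notation J := (ideal_exp (powers_ideal K n d) k).

(** The product [l * g] is a form of degree [d * k] in the [x_i ^ d], hence lies in the ideal, while
    [g] has too small a degree to lie there. *)
Lemma quot_grade_not_inj (l g : {mpoly K[n]}) :
  g != 0 -> g \is (d * k).-1.-homog -> l \is 1.-homog ->
  power_supp d (l * g) ->
  ~ set_inj (@quot_grade K n J (d * k).-1) ( *%R (quot_map J l)).
Proof.
have dk_gt0 : (0 < d * k)%N by rewrite muln_gt0 d_gt0.
move=> g0 hg hl Plg inj; case/negP: g0; apply/eqP.
apply: (@ideal_exp_homog_lt _ _ d k _ (d * k).-1 d_gt0) => //.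
  by rewrite ltn_predL.
rewrite -[g]subr0; apply/quot_map_eq; apply: inj.
- by rewrite inE; exists g.
- by rewrite inE; exists 0 => //=; apply: dhomog0.
rewrite -!rmorphM /=; apply/quot_map_eq; rewrite mulr0 subr0.
apply: power_supp_ideal_exp => //.
by rewrite -(prednK dk_gt0) -add1n dhomogM.
Qed.

Lemma quot_grade_not_surj (l : {mpoly K[n]}) (u z : 'I_n -> K) i j :
  l \is 1.-homog -> l.@[u] = 0 -> l.@[fun k => z k * u k] = 0 ->
  (forall k, z k ^+ d = 1) -> u i != 0 -> u j != 0 -> z i != z j ->
  ~ set_surj (@quot_grade K n J (d * k).-1) (@quot_grade K n J (d * k).-1.+1)
      ( *%R (quot_map J l)).
Proof.
have dk_gt0 : (0 < d * k)%N by rewrite muln_gt0 d_gt0.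
move=> hl lu lzu zd ui uj zij; rewrite prednK // => surj.
(* From [u] to [z * u] the value of [q] is multiplied by [z i ^+ (d * k).-1 * z j], that is, by
   [z j / z i], which is not 1. So [q] is not in the image. *)
pose q : {mpoly K[n]} := 'X_i ^+ (d * k).-1 * 'X_j.
have hX e : ('X_e : {mpoly K[n]}) \is 1.-homog by rewrite dhomogX; apply/eqP/mdeg1.
have hq : q \is (d * k).-homog.
  by rewrite -(prednK dk_gt0) -addn1 dhomogM // -[X in X.-homog]mul1n dhomogMn.
have [|_ [g hg <-]] := surj (quot_map J q); first by exists q.
rewrite -rmorphM /= => /esym/quot_map_eq Iq.
have hqlg : q - l * g \is (d * k).-homog.
  by rewrite rpredB // -(prednK dk_gt0) -add1n dhomogM.
have := power_supp_meval u zd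
  (ideal_exp_homog_supp d_gt0 hqlg Iq).
rewrite /q !mevalB !mevalM lu lzu !mul0r !subr0 !rmorphXn /= !mevalXU.
rewrite exprMn mulrACA -[RHS]mul1r => /mulIf zz; case/eqP: zij.
rewrite -[z i]mulr1 -{}zz; last by rewrite mulf_neq0 // expf_neq0.
by rewrite mulrA -exprS prednK // exprM zd expr1n mul1r.
Qed.

End QuotientMaps.

(** * Both obstructions for an arbitrary linear form *)

Theorem theorem16 (R : realType) (n d k : nat)
    (hn : (3 <= n)%N) (hd : (2 <= d)%N) (hk : (d ^ (n - 2) <= k)%N)
    (hnd : (n, d) <> (3%N, 2%N)) :
  ~ weak_lefschetz (@T_grade R n d k).
Proof.
have d_gt0 : (0 < d)%N by apply: ltnW.
have k_gt0 : (0 < k)%N by apply: leq_trans hk; rewrite expn_gt0 d_gt0.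
have [w w_prim] := prim_root_exists R[i] d_gt0.
move=> [_ [l hl <-]] /(_ (d * k).-1)[]; last first.
  have [u [z [i [j [zd lu lzu [ui uj zij]]]]]] :=
    hyperplane_conjugate_points (fun e => l@_U_(e)) hn hd hnd w_prim.
  by apply: quot_grade_not_surj ui uj zij; rewrite ?meval_homog1.
case: n hn hk hnd l hl => [|[|[|n]]] // _ hk _ l hl.
pose x : {mpoly R[i][n.+3]} := 'X_ord0.
have x0 : x != 0.
  by apply/eqP => /mpolyP/(_ U_(ord0)%MM)/eqP; rewrite mcoeffX mcoeff0 eqxx oner_eq0.
have hx e : x ^+ e \is e.-homog.
  by rewrite -[X in X.-homog]mul1n dhomogMn // dhomogX; apply/eqP/mdeg1.
(* The norm argument needs a nonzero [l]; the zero form kills any form of degree [d * k - 1]. *)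
have [l0|l0] := eqVneq l 0.
  apply: (quot_grade_not_inj d_gt0 k_gt0 (g := x ^+ (d * k).-1)) => //.
    by rewrite expf_neq0.
  by rewrite l0 mul0r => m; rewrite msupp0.
(* Norms are taken in all variables but the last, which keeps the degree of [l * g] down to [d * D],
   at most [d * k] by [hk]. *)
have [g [g0 hg Pg]] := partial_norm w_prim (leqnSn n.+2) l0 hl.

set D := (d ^ (n.+3 - 2))%N in hk.
have dD : (d ^ n.+2 = d * D)%N by rewrite -expnS /D !subSS subn0.
have hlg : l * g \is (d * D).-homog.
  have -> : (d * D = 1 + (d ^ n.+2).-1)%N by rewrite -dD add1n prednK ?expn_gt0 ?d_gt0.
  exact: dhomogM.
apply: (quot_grade_not_inj d_gt0 k_gt0 (g := g * x ^+ (d * (k - D)))) => //.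
- by rewrite mulf_neq0 // expf_neq0.
- have -> : (d * k).-1 = ((d ^ n.+2).-1 + d * (k - D))%N.
    have : (0 < d * D)%N by rewrite -dD expn_gt0 d_gt0.
    by rewrite dD; nia.
  exact: dhomogM.
have Plg : power_supp d (l * g).
  (* For the last variable, [d] divides the total degree [d * D] and all the other exponents, hence
     the remaining one. *)
  move=> m mlg i; have [/Pg->//|] := ltnP i n.+2; rewrite leq_eqVlt ltnNge.
  rewrite -ltnS ltn_ord orbF => /eqP iE.
  have /(congr1 (dvdn d)) := dhomog_mf hlg mlg : mdeg m = _.
  rewrite mdegE dvdn_mulr // big_ord_recr /= dvdn_addr.
    by move=> dm; rewrite (_ : i = ord_max) //; exact: ord_inj.
  elim/big_ind: _ => [|a b da db|j _]; [exact: dvdn0 | exact: dvdn_add |].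
  by apply: (Pg _ mlg); rewrite /= ltn_ord.
rewrite mulrA => m /msuppM_le/allpairsP[[m1 m2] /= [m1l m2x ->]] i.
rewrite mnmDE dvdn_add ?(Plg _ m1l) //.
move: m2x; rewrite mpolyXn msuppX inE => /eqP->.
by rewrite !mulmnE mulnCA dvdn_mulr.
Qed.
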